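(* Let $\epsilon>0$ and suppose that the functions $c_{ij}:\mathbb{S}\to\mathbb{R}$, $1\le i,j\le d$, are continuous. Consider the entropy penalized model, with operators $\mathcal{G}$ and $\mathcal{K}$. Then there exist a pair of vectors $(\bar\pi,\bar V)\in\mathbb{S}\times\mathbb{R}^d$ and a constant $\bar\lambda\in\mathbb{R}$ such that $$\mathcal{G}_{\bar\pi}(\bar V)=\bar\lambda+\bar V$$ and $\bar\pi=\bar\pi\bar P=\mathcal{K}_{\bar V}(\bar\pi)$, where $\bar P=P(\bar\pi,\bar V)$.
   Context: Let $d>1$ be an integer and $\mathbb{S}=\{(q_1,\dots,q_d): q_j\ge 0\ \forall j,\ \sum_{j=1}^d q_j=1\}$. The entropy penalized model is given by $e_i(\pi,P,V)=\sum_j P_{ij}\left(c_{ij}(\pi)+\epsilon\ln P_{ij}+V_j\right)$ for $\pi\in\mathbb{S}$, $V\in\mathbb{R}^d$ and $P$ a $d\times d$ row-stochastic matrix (with $0\ln 0=0$). Its unique minimizing transition matrix (each row $P_{i\cdot}$ minimizing $e_i$) is $P_{ij}(\pi,V)=\dfrac{e^{-(c_{ij}(\pi)+V_j)/\epsilon}}{\sum_k e^{-(c_{ik}(\pi)+V_k)/\epsilon}}$. Define $\mathcal{G}_\pi(V)_i=e_i(\pi,P(\pi,V),V)=-\epsilon\ln\left[\sum_k e^{-(c_{ik}(\pi)+V_k)/\epsilon}\right]$ and $\mathcal{K}_V(\pi)=\pi P(\pi,V)$ (row vector times matrix). Adding a scalar to a vector means adding it to every component. *)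

(* Defs.v *)
From HB Require Import structures.
From mathcomp Require Import all_boot all_order all_algebra.
From mathcomp Require Import all_classical all_reals all_analysis.
From mathcomp Require Import ring lra.

Set Implicit Arguments.
Unset Strict Implicit.
Unset Printing Implicit Defensive.

Import Order.TTheory GRing.Theory Num.Theory.
Import numFieldNormedType.Exports.

Local Open Scope classical_set_scope.
Local Open Scope ring_scope.

Definition simplex (R : realType) (d : nat) : set 'rV[R]_d :=
  [set q | (forall j, 0 <= q 0 j) /\ \sum_j q 0 j = 1].

Definition row_stochastic (R : realType) (d : nat) : set 'M[R]_d :=
  [set P | forall i, simplex (row i P)].

Section EntropyPenalizedModel.
Variables (R : realType) (d : nat).
(* Only the values of the costs on the simplex are meaningful. *)
Variables (eps : R) (c : 'I_d -> 'I_d -> 'rV[R]_d -> R).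

(* The convention 0 ln 0 = 0 holds since ln is total, with ln 0 = 0. *)
Definition ep_cost (i : 'I_d) (pi : 'rV[R]_d) (P : 'M[R]_d) (V : 'rV[R]_d)
  : R :=
  \sum_j P i j * (c i j pi + eps * ln (P i j) + V 0 j).

(* Row i is the unique minimizer of ep_cost i over stochastic rows:
   see ep_transition_minimizer. *)
Definition ep_transition (pi V : 'rV[R]_d) : 'M[R]_d :=
  \matrix_(i, j) (expR (- (c i j pi + V 0 j) / eps) /
                  \sum_k expR (- (c i k pi + V 0 k) / eps)).

(* ep_GE gives the closed log-sum-exp form. *)
Definition ep_G (pi V : 'rV[R]_d) : 'rV[R]_d :=
  \row_i ep_cost i pi (ep_transition pi V) V.

Definition ep_K (V pi : 'rV[R]_d) : 'rV[R]_d :=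
  pi *m ep_transition pi V.

Lemma ep_norm_gt0 (i : 'I_d) (pi V : 'rV[R]_d) :
  0 < \sum_k expR (- (c i k pi + V 0 k) / eps).
Proof.
rewrite (bigD1 i) //= ltr_wpDr ?expR_gt0 //.
by apply: sumr_ge0 => k _; exact: expR_ge0.
Qed.

Lemma ep_transition_gt0 (pi V : 'rV[R]_d) (i j : 'I_d) :
  0 < ep_transition pi V i j.
Proof. by rewrite mxE divr_gt0 ?expR_gt0 ?ep_norm_gt0. Qed.

Lemma ep_transition_sum (pi V : 'rV[R]_d) (i : 'I_d) :
  \sum_j ep_transition pi V i j = 1.
Proof.
under eq_bigr do rewrite mxE.
by rewrite -mulr_suml divff // gt_eqF ?ep_norm_gt0.
Qed.

Lemma ep_transition_stochastic (pi V : 'rV[R]_d) :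
  row_stochastic (ep_transition pi V).
Proof.
move=> i; split=> [j|]; first by rewrite mxE ltW ?ep_transition_gt0.
by under eq_bigr do rewrite mxE; exact: ep_transition_sum.
Qed.

Hypothesis eps_gt0 : 0 < eps.

Lemma ep_ln_transition (pi V : 'rV[R]_d) (i j : 'I_d) :
  eps * ln (ep_transition pi V i j) =
  - (c i j pi + V 0 j) - eps * ln (\sum_k expR (- (c i k pi + V 0 k) / eps)).
Proof.
rewrite mxE ln_div ?posrE ?expR_gt0 ?ep_norm_gt0 // expRK mulrBr.
by rewrite mulrCA divff ?mulr1 // gt_eqF.
Qed.

Lemma ep_GE (pi V : 'rV[R]_d) (i : 'I_d) :
  ep_G pi V 0 i = - eps * ln (\sum_k expR (- (c i k pi + V 0 k) / eps)).
Proof.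
rewrite mxE /ep_cost.
under eq_bigr do rewrite ep_ln_transition.
set L := ln _.
rewrite (eq_bigr (fun j => ep_transition pi V i j * (- eps * L))); last first.
  by move=> j _; ring.
by rewrite -mulr_suml ep_transition_sum mul1r.
Qed.

(* Gibbs' inequality, one term at a time. *)
Lemma gibbs_term (p q : R) : 0 <= p -> 0 < q ->
  p - q <= p * (ln p - ln q) ?= iff (p == q).
Proof.
move=> p0 q0; case: (ltgtP p 0) p0 => // [p0 _|-> _]; last first.
  by apply/leifP; rewrite mul0r; case: eqP => [q'|_]; lra.
apply/leifP; case: eqVneq => [->|pq]; first by rewrite !subrr mulr0.
have x0 : 0 < q / p by rewrite divr_gt0.
have lnx0 : ln (q / p) != 0.
  by rewrite ln_eq0 //; apply: contra pq => /eqP /divr1_eq ->.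
have := expR_gt1Dx lnx0.
rewrite lnK ?posrE // ln_div ?posrE // -(ltr_pM2l p0) mulrCA divff ?gt_eqF //.
lra.
Qed.

Lemma ep_transition_minimizer (pi V : 'rV[R]_d) (i : 'I_d) (P : 'M[R]_d) :
  row_stochastic P ->
  ep_cost i pi (ep_transition pi V) V <= ep_cost i pi P V
    ?= iff (row i P == row i (ep_transition pi V)).
Proof.
move=> /(_ i)[P0 P1]; set Q := ep_transition pi V.
have {}P0 j : 0 <= P i j by have := P0 j; rewrite mxE.
have {}P1 : \sum_j P i j = 1 by rewrite -P1; apply: eq_bigr => j _; rewrite mxE.
have gibbs : 0 <= \sum_j P i j * (ln (P i j) - ln (Q i j))
    ?= iff [forall j, P i j == Q i j].
  have := @leif_sum R 'I_d xpredT (fun j => P i j == Q i j)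
    (fun j => P i j - Q i j) (fun j => P i j * (ln (P i j) - ln (Q i j))).
  rewrite sumrB P1 ep_transition_sum subrr; apply=> j _.
  by apply: gibbs_term => //; exact: ep_transition_gt0.
have costP : ep_cost i pi P V = ep_cost i pi Q V +
    eps * \sum_j P i j * (ln (P i j) - ln (Q i j)).
  have -> : ep_cost i pi Q V = ep_G pi V 0 i by rewrite mxE.
  rewrite ep_GE -[X in X + _]mul1r -[in X in X * _ + _]P1.
  rewrite mulr_suml mulr_sumr -big_split /=; apply: eq_bigr => j _.
  have -> : eps * (P i j * (ln (P i j) - ln (Q i j))) =
      P i j * (eps * ln (P i j)) - P i j * (eps * ln (Q i j)) by ring.
  rewrite ep_ln_transition; ring.
have -> : (row i P == row i Q) = [forall j, P i j == Q i j].
  apply/eqP/forallP => [/rowP PQ j|PQ].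
    by have := PQ j; rewrite mxE [RHS]mxE => ->.
  by apply/rowP => j; rewrite mxE [RHS]mxE; exact/eqP.
rewrite costP; split; first by rewrite lerDl mulr_ge0 ?gibbs.1 ?ltW.
rewrite -gibbs.2 -subr_eq0 opprD addrA subrr add0r oppr_eq0 mulf_eq0.
by rewrite (gt_eqF eps_gt0) [RHS]eq_sym.
Qed.

End EntropyPenalizedModel.

(* Main.v *)
Require Import Defs.
From mathcomp Require Import all_boot zify.
Set Implicit Arguments.
Unset Strict Implicit.

(* With [a_ij = exp (- c_ij / eps)] and [v_j = exp (- V_j / eps)], the equation
   for [V] says that [v] is a positive eigenvector of [a (pi)], and
   [P_ij = a_ij v_j / (a v)_i]. A solution is therefore a fixed point of
   [(pi, v) |-> (pi P, a v / \sum_i (a v)_i)], a continuous self-map of the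
   product of two simplices; any fixed point has [v > 0] since [a > 0], so no
   Perron-Frobenius theory is needed. Halving both components turns this into
   a self-map of one simplex, to which Brouwer's theorem applies.

   Brouwer's theorem is derived from Scarf's lemma on finite sets with several
   linear orders, applied to grid points ordered by each coordinate: a point is
   given a colour [i] with [x_i <= f(x)_i], and dominance of a set [S] by the
   orders of its colours forces [S] to be small and its other coordinates to
   be close to [0], so that in the limit [x_i <= f(x)_i] for every [i]. *)

(** * Scarf's lemma *)

Section DominantSets.
Variables (I X : finType) (rk : I -> X -> nat).
Hypothesis rk_inj : forall i, injective (rk i).

(** Equivalently, for nonempty [U], no element exceeds the minima of [U] in all orders at once. *)
Definition dominant (U : {set X}) :=
  [forall x, exists i, forall u in U, rk i x <= rk i u].

Lemma dominantP (U : {set X}) :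
  reflect (forall x, exists i, {in U, forall u, rk i x <= rk i u})
          (dominant U).
Proof.
apply: (iffP forallP) => UP x.
  by have /existsP[i /forall_inP] := UP x; exists i.
by have [i xU] := UP x; apply/existsP; exists i; apply/forall_inP.
Qed.

Lemma lowest_exists (U : {set X}) : U != set0 ->
  exists m : I -> X, forall i,
    m i \in U /\ {in U, forall u, rk i (m i) <= rk i u}.
Proof.
move=> /set0Pn[u0 u0U].
exists (fun i => [arg min_(u < u0 in U) rk i u]) => i.
by case: arg_minnP => // u uU umin; split.
Qed.

(** [U] has fewer elements than there are orders, so two orders [i] and [j] share their minimum [m].
    A new element must become the minimum of one of these two while staying above the old minima of
    all other orders; dominance forces it to be the highest such element. This leaves one candidate
    for [i] and one for [j]. *)
Lemma card_extension (U : {set X}) :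
    U != set0 -> #|U|.+1 = #|I| -> dominant U ->
    (forall k, exists x, forall l, l != k ->
       exists2 u, u \in U & rk l u < rk l x) ->
  #|[set x in ~: U | dominant (x |: U)]| = 2.
Proof.
move=> U0 cardU /dominantP domU above.
have [m mP] := lowest_exists U0.
have mU i : m i \in U by have [] := mP i.
have m_le i u : u \in U -> rk i (m i) <= rk i u by have [_] := mP i; apply.
have /injectivePn[i [j ij mij]] : ~~ injectiveb m.
  apply/injectiveP => m_inj.
  have : #|m @: [set: I]| <= #|U|.
    by apply: subset_leq_card; apply/subsetP => _ /imsetP[k _ ->].
  by rewrite card_imset // cardsT -cardU ltnn.
pose M k := [set x | [forall l, (l != k) ==> (rk l (m l) < rk l x)]].
have MP k x : reflect (forall l, l != k -> rk l (m l) < rk l x) (x \in M k).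
  by rewrite inE; apply: (iffP forallP) => H l; apply/implyP/H.
have M0 k : exists x, x \in M k.
  have [x xP] := above k; exists x; apply/MP => l /xP[u uU].
  exact: leq_ltn_trans (m_le _ _ uU).
pose top k x := x \in M k /\ {in M k, forall y, rk k y <= rk k x}.
have topE k : exists x, top k x.
  have [x0 x0M] := M0 k.
  by exists [arg max_(x > x0 in M k) rk k x]; case: arg_maxnP.
have M_low k x : x \in M k -> rk k x <= rk k (m k).
  move=> /MP xM; have [l xl] := domU x.
  by have [<-|/xM] := eqVneq l k; [exact/xl/mU | rewrite ltnNge xl ?mU].
have top_ext k k' x : k != k' -> m k = m k' -> top k x ->
    (x \notin U) && dominant (x |: U).
  move=> kk' mkk' [xM xtop]; apply/andP; split.
    apply/negP => xU.
    have xmk : x = m k.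
      by apply: (@rk_inj k); apply: anti_leq; rewrite M_low //= m_le.
    have /MP/(_ k') := xM; rewrite eq_sym => /(_ kk').
    by rewrite -mkk' -xmk ltnn.
  apply/dominantP => y; have [yM|] := boolP (y \in M k).
    exists k => u /setU1P[->|/(m_le k)]; first exact: xtop.
    exact/leq_trans/M_low.
  rewrite inE negb_forall => /existsP[l].
  rewrite negb_imply -leqNgt => /andP[lk yl].
  exists l => u /setU1P[->|/(m_le l)]; last exact: leq_trans.
  by apply: leq_trans yl (ltnW _); move/MP: xM; apply.
have ext_top x : x \notin U -> dominant (x |: U) -> top i x \/ top j x.
  move=> xU /dominantP domV; set V := x |: U in domV.
  have [|mV mVP] := @lowest_exists V.
    by apply/set0Pn; exists x; rewrite setU11.
  have mV_surj v : v \in V -> exists k, v = mV k.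
    move=> vV; have [k vk] := domV v; exists k.
    have [mVV mVk] := mVP k.
    by apply: (@rk_inj k); apply: anti_leq; rewrite vk ?mVk.
  (* By dominance each element of [V] is a minimum for some order; as [V] has one element per order,
     the minima are distinct. *)
  have mV_inj : injective mV.
    suff /imset_injP mV_inj : #|mV @: [set: I]| == #|[set: I]|.
      by move=> k l; apply: mV_inj; rewrite inE.
    rewrite eqn_leq leq_imset_card cardsT -cardU -add1n.
    have <- : #|V| = 1 + #|U| by rewrite cardsU1 xU.
    apply: subset_leq_card; apply/subsetP => v /mV_surj[k ->].
    exact: imset_f.
  have [k xk] := mV_surj x (setU11 _ _).
  have mVm l : l != k -> mV l = m l.
    move=> lk; have [/setU1P[mVx|mVU] mVl] := mVP l.
      by move: mVx; rewrite xk => /mV_inj/eqP; rewrite (negPf lk).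
    by apply: (@rk_inj l); apply: anti_leq; rewrite m_le // mVl // setU1r.
  have xM : x \in M k.
    apply/MP => l lk; rewrite ltn_neqAle -mVm //.
    have [_ ->] := mVP l; last exact: setU11.
    rewrite andbT; apply: contraNneq lk => /rk_inj; rewrite {1}xk.
    by move/mV_inj => ->.
  have xtop : top k x.
    split=> // y /MP yM; have [l yl] := domV y.
    have [<-|lk] := eqVneq l k; first by rewrite yl ?setU11.
    by have := yM l lk; rewrite ltnNge yl // setU1r.
  have [<-|ik] := eqVneq k i; first by left.
  have [<-|jk] := eqVneq k j; first by right.
  have /mV_inj/eqP : mV i = mV j by rewrite !mVm // eq_sym.
  by rewrite (negPf ij).
have top_inj k x y : top k x -> top k y -> x = y.
  move=> [xM xt] [yM yt].
  by apply: (@rk_inj k); apply: anti_leq; rewrite xt ?yt.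
have [xi ti] := topE i; have [xj tj] := topE j.
have -> : [set x in ~: U | dominant (x |: U)] = [set xi; xj].
  apply/setP => x; rewrite !inE; apply/andP/orP.
    move=> [xU /(ext_top _ xU)[tx|tx]]; [left|right].
      by rewrite (top_inj _ _ _ tx ti).
    by rewrite (top_inj _ _ _ tx tj).
  case=> /eqP ->; apply/andP; first exact: top_ext ij mij ti.
  by apply: top_ext (esym mij) tj; rewrite eq_sym.
(* If the two candidates coincided, that element would exceed the minimum of [U] in every order,
   against dominance. *)
rewrite cards2; case: eqVneq => // xij.
have [iM _] := ti; have [jM _] := tj.
have [l xl] := domU xi; have := xl _ (mU l); rewrite leqNgt => /negP[].
have [li|] := eqVneq l i; last by move/MP: iM; apply.
by move/MP: jM; rewrite xij; apply; rewrite li.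
Qed.

(* A room is a dominant set with one element per colour; its doors are the
   facets bearing all colours but [i0]. *)
Lemma odd_doors (c : X -> I) (i0 : I) (V : {set X}) : #|V| = #|I| ->
  odd #|[set x in V | c @: (V :\ x) == [set~ i0]]| -> c @: V = [set: I].
Proof.
move=> cardV; set D := [set x in V | _].
have [->|/set0Pn[x xD]] := eqVneq D set0; first by rewrite cards0.
have [xV /eqP cx] : x \in V /\ c @: (V :\ x) == [set~ i0].
  by move: xD; rewrite inE => /andP.
have door_inj z : z \in D -> {in V :\ z &, injective c}.
  rewrite inE => /andP[zV /eqP cz]; apply/imset_injP; rewrite cz.
  by rewrite cardsC1 -cardV (cardsD1 z V) zV.
have cVx : c @: V = c x |: c @: (V :\ x) by rewrite -{1}(setD1K xV) imsetU1.
have [cxi0|cxi0] := eqVneq (c x) i0.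
  by rewrite cVx cx cxi0 => _; apply/setP => k; rewrite !inE; case: eqP.
(* Otherwise [x] shares its colour with some [y], and exactly the removals of [x] and of [y] give
   doors: an even number. *)
have : c x \in c @: (V :\ x) by rewrite cx !inE.
move=> /imsetP[y yV cxy].
have yx : y != x by move: yV; rewrite !inE => /andP[].
have yV' : y \in V by move: yV; rewrite !inE => /andP[].
suff -> : D = [set x; y] by rewrite cards2 eq_sym yx.
apply/setP => z; rewrite !inE; apply/andP/orP.
  move=> [zV cz]; have [->|zx] := eqVneq z x; first by left.
  right; apply: contraT => zy; suff /eqP : x = y by rewrite eq_sym (negPf yx).
  by apply: (door_inj z) => //; rewrite !inE ?cz ?zV // eq_sym ?zx ?zy ?xV ?yV'.
case=> /eqP ->; split=> //; first by rewrite cx.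
rewrite -cx; apply/eqP.
have -> : V :\ x = y |: (V :\ x :\ y) by rewrite setD1K.
have -> : V :\ y = x |: (V :\ x :\ y).
  rewrite setDDl [[set x] :|: [set y]]setUC -setDDl setD1K //.
  by rewrite !inE xV eq_sym yx.
by rewrite !imsetU1 cxy.
Qed.

(** Pairs of a room and one of its doors are counted twice. Each door lies in two rooms, except
    [U0], which lies in one; the total is odd, so some room has an odd number of doors. *)
Lemma full_room (c : X -> I) (i0 : I) (U0 : {set X}) :
    let doors :=
      [set U | [&& dominant U, #|U|.+1 == #|I| & c @: U == [set~ i0]]] in
    U0 \in doors ->
    #|[set x in ~: U0 | dominant (x |: U0)]| = 1 ->
    {in doors :\ U0, forall U, #|[set x in ~: U | dominant (x |: U)]| = 2} ->
  exists2 V, dominant V & c @: V = [set: I].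
Proof.
move=> doors U0D U0ext ext.
have dominantS (U V : {set X}) : U \subset V -> dominant V -> dominant U.
  move=> /subsetP UV /dominantP dV; apply/dominantP => x.
  by have [i xi] := dV x; exists i => u /UV; exact: xi.
pose rooms := [set V | dominant V && (#|V| == #|I|)].
pose cnt (V : {set X}) := #|[set x in V | c @: (V :\ x) == [set~ i0]]|.
have : odd (\sum_(V in rooms) cnt V).
  suff -> : \sum_(V in rooms) cnt V =
      \sum_(U in doors) #|[set x in ~: U | dominant (x |: U)]|.
    rewrite (bigD1 U0) //= U0ext.
    rewrite (eq_bigr (fun=> 2)) ?sum_nat_const ?oddD ?oddM ?andbF //.
    by move=> U /andP[UD UU0]; rewrite ext // in_setD1 UU0.
  under eq_bigr do rewrite /cnt -sum1_card.
  under [RHS]eq_bigr do rewrite -sum1_card.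
  rewrite (exchange_big_dep xpredT) //= [RHS](exchange_big_dep xpredT) //=.
  apply: eq_bigr => x _.
  rewrite (reindex_onto (fun U => x |: U) (fun V => V :\ x)) /=; last first.
    by move=> V; rewrite !inE => /andP[_ /andP[xV _]]; rewrite setD1K.
  apply: eq_bigl => U; rewrite !inE eqxx /=.
  have [xU|xU] := boolP (x \in U).
    rewrite andbF; apply/negP => /andP[_ /eqP UE].
    by move: xU; rewrite -UE !inE eqxx.
  rewrite setU1K // eqxx andbT cardsU1 xU add1n /=.
  have [dV|] := boolP (dominant (x |: U)); last by rewrite !andbF.
  by rewrite (dominantS U _ _ dV) ?subsetUr //= andbT.
case: (pickP [pred V in rooms | odd (cnt V)]) => [V|noV].
  rewrite !inE => /andP[/andP[dV /eqP cardV] oddV] _.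
  by exists V => //; exact: odd_doors oddV.
suff -> : odd (\sum_(V in rooms) cnt V) = false by [].
elim/big_ind: _ => // [m n|V VR]; first by rewrite oddD => -> ->.
by have := noV V; rewrite /= VR.
Qed.

End DominantSets.

(* Scarf's slack elements: [inr i] is the lowest element for the [i]th order
   and exceeds all of [T] for the other orders. *)
Definition slack_rank {I T : finType} (rk : I -> T -> nat) (i : I)
    (x : T + I) : nat :=
  match x with
  | inl t => (rk i t).+1
  | inr j => if i == j then 0 else (\max_k \max_t rk k t).+2 + enum_rank j
  end.

(** The exceptional door consists of all slack elements but [inr i0]; it extends only by the element
    of [T] highest for [rk i0]. *)
Lemma scarf {I T : finType} (rk : I -> T -> nat) (c : T -> I) (t0 : T) :
    (forall i, injective (rk i)) ->
  exists S : {set T}, forall t, exists2 i, i \in c @: S &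
    {in S, forall s, rk i t <= rk i s}.
Proof.
move=> rk_inj; pose rks := slack_rank rk; pose i0 := c t0.
have rk_max i t : rk i t <= \max_k \max_t rk k t.
  by apply: leq_trans (leq_bigmax i); apply: (leq_bigmax t).
have rks_slack i x : rks i (inr i) <= rks i x by rewrite /rks /= eqxx.
have rks_lt i t : rks i (inr i) < rks i (inl t) by rewrite /rks /= eqxx.
have rks_gt i j t : i != j -> rks i (inl t) < rks i (inr j).
  move=> /negPf ij; rewrite /rks /= ij.
  by apply: leq_trans (leq_addr _ _); rewrite !ltnS.
have rks_inj i : injective (rks i).
  move=> [t|j] [t'|j'].
  - by case=> /rk_inj ->.
  - have [<-|/rks_gt-/(_ t)] := eqVneq i j'; first by rewrite /rks /= eqxx.
    by move=> lt E; move: lt; rewrite E ltnn.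
  - have [<-|/rks_gt-/(_ t')] := eqVneq i j; first by rewrite /rks /= eqxx.
    by move=> lt E; move: lt; rewrite E ltnn.
  rewrite /rks /=; case: (eqVneq i j) (eqVneq i j') => [<-|_] [<-|_] //.
  by move=> /addnI/val_inj/enum_rank_inj ->.
pose cs (x : T + I) := match x with inl t => c t | inr j => j end.
pose U0 : {set T + I} := inr @: [set~ i0].
have inr_inj : injective (@inr T I) by move=> ? ? [].
have cardU0 : #|U0|.+1 = #|I|.
  by rewrite card_imset // cardsC1 prednK //; apply/card_gt0P; exists i0.
have inU0 j : (inr j \in U0) = (j != i0) by rewrite mem_imset // !inE.
have inlU0 t : inl t \in U0 = false by apply/imsetP => -[].
have csU0 : cs @: U0 = [set~ i0].
  by rewrite -imset_comp (eq_imset _ (g := id)) ?imset_id.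
have domE t U : dominant rks U ->
    exists2 i, inr i \notin U & {in U, forall u, rks i (inl t) <= rks i u}.
  move=> /dominantP/(_ (inl t))[i ti]; exists i => //.
  by apply/negP => /ti; rewrite leqNgt rks_lt.
have [||U|V domV csV] := @full_room I _ rks cs i0 U0.
- rewrite inE cardU0 csU0 !eqxx /= andbT; apply/dominantP => -[t|j].
    exists i0 => u /imsetP[j]; rewrite !inE => ji0 ->.
    by apply/ltnW/rks_gt; rewrite eq_sym.
  by exists j => u _.
- pose t1 := [arg max_(t > t0) rk i0 t].
  rewrite -(cards1 (inl t1 : T + I)); apply: eq_card => x.
  rewrite !inE; apply/andP/eqP => [[]|->].
    case: x => [t _|j]; last first.
      rewrite inU0 negbK => /eqP -> /(domE t0)[i].
      by rewrite !inE inU0 -[inr i == _]/(i == i0) orbN.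
    move=> dom; congr inl; apply: (rk_inj i0).
    apply: anti_leq; rewrite /t1; case: arg_maxnP => // t2 _ t2P.
    apply/andP; split; first exact: t2P.
    have [i] := domE t2 _ dom.
    rewrite !inE /= inU0 negbK => /eqP -> /(_ (inl t)).
    by rewrite !inE eqxx; apply.
  rewrite inlU0; split=> //; apply/dominantP => -[t|j]; last by exists j => u _.
  exists i0 => u /setU1P[->|/imsetP[j]].
    by rewrite /rks /= ltnS /t1; case: arg_maxnP => // t2 _; apply.
  by rewrite !inE => ji0 ->; apply/ltnW/rks_gt; rewrite eq_sym.
- rewrite !inE => /andP[UU0 /and3P[domU /eqP cardU /eqP csU]].
  (* A door made of slack elements only would be contained in [U0] and have the same size, hence
     equal it. *)
  have [t tU] : exists t, inl t \in U.
    case: (pickP (fun t => inl t \in U)) => [t tU|noU]; first by exists t.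
    case/eqP: UU0; apply/eqP; rewrite eqEcard.
    rewrite -ltnS cardU0 cardU leqnn andbT.
    apply/subsetP => -[t|j jU]; first by rewrite noU.
    by have := imset_f cs jU; rewrite csU inU0 !inE.
  apply: card_extension => //; first by apply/set0Pn; exists (inl t).
  by move=> k; exists (inr k) => l lk; exists (inl t) => //; exact: rks_gt.
(* An order [i] that dominates an element of [T] excludes [inr i] from [V], so the colour [i] is
   borne by an element of [T]. *)
exists [set t | inl t \in V] => t.
have [i Vi ti] := domE t V domV; exists i => [|s].
  have /imsetP[[s|j] Vj ij] : i \in cs @: V by rewrite csV.
    by rewrite ij; apply: imset_f; rewrite inE.
  by case/negP: Vi; rewrite ij.
by rewrite inE => /ti.
Qed.

(** * Colourings of the lattice points of a simplex *)

(** Scarf's lemma gives a set [S] with colours [C]. Let [nu] be its coordinatewise minimum on [C],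
    and zero elsewhere. No lattice point exceeds [nu] on all of [C], which forces the sum of [nu]
    above [N - #|I|]; hence all points of [S] are within [#|I|] of [nu]. *)
Lemma grid_colours {I : finType} (N : nat) (c : {ffun I -> 'I_N.+1} -> I) :
    0 < #|I| ->
  exists2 t : {ffun I -> 'I_N.+1}, \sum_i t i = N &
    forall i, exists2 s : {ffun I -> 'I_N.+1},
      \sum_j s j = N /\ (forall j, s j <= t j + #|I| /\ t j <= s j + #|I|) &
      c s = i \/ s i <= #|I|.
Proof.
move=> /card_gt0P[i0 _].
pose T := {t : {ffun I -> 'I_N.+1} | \sum_i t i == N}.
have gridT (t : I -> nat) : \sum_i t i = N ->
    exists s : T, forall i, val s i = t i :> nat.
  move=> sumt; have t_le i : t i < N.+1 by rewrite ltnS -sumt (bigD1 i) ?leq_addr.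
  pose s : {ffun I -> 'I_N.+1} := [ffun i => Ordinal (t_le i)].
  have sE i : s i = t i :> nat by rewrite ffunE.
  have sP : \sum_i s i == N by rewrite (eq_bigr t) ?sumt.
  by exists (exist _ s sP).
have sumT (s : T) : \sum_i val s i = N by apply/eqP/(valP s).
have [t0 _] : exists t : T, forall i, val t i = (i == i0) * N :> nat.
  by apply: gridT; rewrite (bigD1 i0) //= eqxx mul1n big1 ?addn0 // => i /negPf->.
(* Ties between equal coordinates are broken by an enumeration of [T]. *)
pose rk i (t : T) := val t i * #|{: T}| + enum_rank t.
have rk_inj i : injective (rk i).
  move=> s t /(congr1 (modn^~ #|{: T}|)).
  by rewrite !modnMDl !modn_small // => /val_inj/enum_rank_inj.
have rk_le i s t : rk i s <= rk i t -> val s i <= val t i.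
  apply: contraTT; rewrite -!ltnNge /rk => ts.
  apply: (@leq_trans ((val t i).+1 * #|{: T}|)); first by rewrite mulSnr ltn_add2l.
  by apply: leq_trans (leq_addr _ _); rewrite leq_mul2r ts orbT.
have [S domS] := scarf (fun t : T => c (val t)) t0 rk_inj.
set C := [set c (val x) | x in S] in domS.
have [i1 i1C _] := domS t0.
have /imsetP[s0 s0S _] := i1C.
have [|m mP] := lowest_exists (fun i (t : T) => val t i : nat) (U := S).
  by apply/set0Pn; exists s0.
pose nu i := if i \in C then val (m i) i : nat else 0.
have nu_le s i : s \in S -> nu i <= val s i.
  by rewrite /nu; case: ifP => // _ sS; have [_] := mP i; apply.
have N_lt : N < \sum_(i in C) (nu i).+1.
  rewrite ltnNge; apply/negP => sumN.
  (* Exceeds [nu] on [C]; the surplus put on [i1] brings the coordinate sum to [N]. *)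
  pose t i := (i \in C) * (nu i).+1 + (i == i1) * (N - \sum_(i in C) (nu i).+1).
  have [|s sE] := gridT t.
    rewrite /t big_split /= [X in _ + X](bigD1 i1) //= eqxx mul1n.
    rewrite [X in _ + (_ + X)]big1 ?addn0; last by move=> i /negPf->.
    have -> : \sum_i (i \in C) * (nu i).+1 = \sum_(i in C) (nu i).+1.
      by rewrite [RHS]big_mkcond; apply: eq_bigr => i _; case: ifP; rewrite ?mul1n.
    by rewrite subnKC.
  have [i iC si] := domS s.
  have [/si/rk_le + _] := mP i; rewrite sE /t iC mul1n leqNgt => /negP; apply.
  by rewrite /nu iC ltnS leq_addr.
have nu_gt s i : s \in S -> val s i < nu i + #|I|.
  move=> sS; have : N < \sum_i nu i + #|I|.
    apply: leq_trans N_lt _; rewrite -sum1_card -big_split /= big_mkcond /=.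
    by apply: leq_sum => j _; case: ifP => // _; rewrite addn1.
  have := sumT s; rewrite !(bigD1 (P := xpredT) i) //=.
  have : \sum_(j | j != i) nu j <= \sum_(j | j != i) val s j.
    by apply: leq_sum => j _; exact: nu_le.
  move: (\sum_(j | _) _) (\sum_(j | _) _) => a b; lia.
have close s t j : s \in S -> t \in S -> val s j <= val t j + #|I|.
  move=> sS tS; apply: leq_trans (ltnW (nu_gt _ _ sS)) _.
  by rewrite leq_add2r nu_le.
exists (val s0) => // i; have [/imsetP[s sS ->]|iC] := boolP (i \in C).
  by exists (val s); [split=> // j; rewrite !close | left].
exists (val s0); first by split=> // j; rewrite !close.
by right; have := nu_gt s0 i s0S; rewrite /nu (negPf iC) => /ltnW.
Qed.

From mathcomp Require Import all_order all_algebra.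
From mathcomp Require Import all_classical all_reals all_analysis.
From mathcomp Require Import ring lra.
Import Order.TTheory GRing.Theory Num.Theory.
Import numFieldNormedType.Exports.
Local Open Scope classical_set_scope.
Local Open Scope ring_scope.

(** * Brouwer's theorem on the simplex *)

Lemma cvg_sumr (R : realType) (T : Type) (F : set_system T) (I : finType)
    (f : I -> T -> R) (l : I -> R) : Filter F ->
  (forall i, f i x @[x --> F] --> l i) ->
  \sum_i f i x @[x --> F] --> \sum_i l i.
Proof.
by move=> FF fl; apply: (@cvg_big _ _ +%R) => //; exact: add_continuous.
Qed.

Lemma continuous_simplex_sum (R : realType) (n : nat) :
  continuous (fun x : 'rV[R]_n => \sum_j x 0 j).
Proof. by move=> x; apply: (cvg_sumr (F := nbhs x)) => j; exact: coord_continuous. Qed.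

Lemma compact_simplex (R : realType) (n : nat) : compact (@simplex R n).
Proof.
pose box := [set x : 'rV[R]_n | forall j, (fun=> `[0, 1]%classic) j (x ord0 j)].
apply: (@subclosed_compact _ _ box); last 1 first.
- move=> x [x0 x1] j /=; rewrite in_itv /= x0 /= -x1 (bigD1 j) //= lerDl.
  by apply: sumr_ge0.
- have -> : @simplex R n = \bigcap_j [set x : 'rV[R]_n | 0 <= x 0 j] `&`
      [set x : 'rV[R]_n | \sum_j x 0 j = 1].
    by apply/seteqP; split=> x [x0 x1]; split=> // j; [move=> _; exact: x0 | exact: x0].
  apply: closedI.
    apply: closed_bigI => j _.
    apply: (@preimage_closed _ _ (fun x : 'rV[R]_n => x 0 j) [set y | 0 <= y]).
      by move=> x _; exact: coord_continuous.
    exact: closed_ge.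
  apply: (@preimage_closed _ _ (fun x : 'rV[R]_n => \sum_j x 0 j) [set y | y = 1]).
    by move=> x _; exact: continuous_simplex_sum.
  exact: closed_eq.
- by apply: rV_compact => j; exact: segment_compact.
Qed.

Lemma cvg_rV (T : Type) (F : set_system T) (R : realType) (n : nat)
    (f : T -> 'rV[R]_n) (l : 'rV[R]_n) : Filter F ->
  (forall j, f x 0 j @[x --> F] --> l 0 j) -> f x @[x --> F] --> l.
Proof.
move=> FF fl A [P lP PA]; rewrite /nbhs /=.
have : \forall x \near F, forall j, P 0 j (f x 0 j).
  by apply: filter_forall => j; apply: fl; exact: lP.
by apply: filterS => x xP; apply: PA => i j; rewrite ord1.
Qed.

(** On a grid with [n / N0 < e], a point of colour [i] satisfies the inequality without error, and a
    point whose coordinate [i] is at most [n / N0] satisfies it because [f] is nonnegative. *)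
Lemma approximate_fixed_point (R : realType) (n : nat) (f : 'rV[R]_n -> 'rV[R]_n)
    (e : R) : (0 < n)%N -> 0 < e ->
    (forall x, simplex x -> simplex (f x)) ->
  exists2 x, simplex x & forall i, exists2 s,
    simplex s /\ ball x e s & s 0 i <= f s 0 i + e.
Proof.
move=> n0 e0 fS.
have [N0 N0e] : exists N0 : nat, n%:R / e < N0%:R.
  exists (Num.trunc (n%:R / e)).+1; exact: truncnS_gt.
have N0_gt0 : (0 < N0%:R :> R).
  by apply: le_lt_trans N0e; rewrite divr_ge0 // ltW.
have nNe : n%:R / N0%:R < e.
  by rewrite ltr_pdivrMr // mulrC -ltr_pdivrMr.
pose pt (t : {ffun 'I_n -> 'I_N0.+1}) : 'rV[R]_n := \row_i ((t i)%:R / N0%:R).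
have ptS (t : {ffun 'I_n -> 'I_N0.+1}) : (\sum_i t i)%N = N0 -> simplex (pt t).
  move=> tN; split=> [j|]; first by rewrite mxE divr_ge0.
  under eq_bigr do rewrite mxE.
  by rewrite -mulr_suml -natr_sum tN divff // gt_eqF.
(* The default is never reached on the simplex: [x] and [f x] have equal coordinate sums, so some
   coordinate does not decrease. *)
pose c t := odflt (Ordinal n0) [pick i | pt t 0 i <= f (pt t) 0 i].
have cP (t : {ffun 'I_n -> 'I_N0.+1}) : (\sum_i t i)%N = N0 -> pt t 0 (c t) <= f (pt t) 0 (c t).
  move=> /ptS tS; rewrite /c; case: pickP => //= no.
  have : \sum_i f (pt t) 0 i < \sum_i pt t 0 i.
    apply: ltr_sum; first by apply/hasP; exists (Ordinal n0); rewrite ?mem_index_enum.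
    by move=> i _; rewrite ltNge no.
  by have [_ ->] := tS; have [_ ->] := fS _ tS; rewrite ltxx.
have [|t tN near_t] := @grid_colours 'I_n N0 c; first by rewrite card_ord.
exists (pt t); first exact: ptS.
move=> i; have [s [sN st] cs] := near_t i; exists (pt s).
  split; first exact: ptS.
  split=> // k j; rewrite {k}ord1 -ball_normE /= !mxE -mulrBl normrM.
  rewrite (gtr0_norm (x := N0%:R^-1)) ?invr_gt0 //.
  apply: le_lt_trans nNe; rewrite ler_pM2r ?invr_gt0 // ler_norml.
  have [] := st j; rewrite card_ord -!(ler_nat R) !natrD => ? ?.
  by apply/andP; split; lra.
have [<-|si] := cs; first by rewrite (le_trans (cP _ sN)) // lerDl ltW.
have [fs0 _] := fS _ (ptS _ sN).
rewrite (@le_trans _ _ e) ?lerDr // mxE (le_trans _ (ltW nNe)) //.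
by rewrite ler_pM2r ?invr_gt0 // ler_nat; move: si; rewrite card_ord.
Qed.

(** At a cluster point [x] of approximate fixed points, continuity gives [x 0 i <= f x 0 i] for all
    [i]; equal coordinate sums turn these into equalities. *)
Theorem brouwer_simplex (R : realType) (n : nat) (f : 'rV[R]_n -> 'rV[R]_n) :
    (0 < n)%N -> {within @simplex R n, continuous f} ->
    (forall x, simplex x -> simplex (f x)) ->
  exists2 x, simplex x & f x = x.
Proof.
move=> n0 /subspace_continuousP fC fS.
have /choice[u uP] : forall k : nat, exists x, simplex x /\ forall i,
    exists2 s, simplex s /\ ball x k.+1%:R^-1 s & s 0 i <= f s 0 i + k.+1%:R^-1.
  move=> k; have [|x xS xP] := approximate_fixed_point (e := k.+1%:R^-1) n0 _ fS.
    by rewrite invr_gt0.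
  by exists x.
have [|x [xS xu]] := @compact_simplex R n (u @ \oo) _ _.
  by exists 0%N => // k _; have [] := uP k.
have x_le i : x 0 i <= f x 0 i.
  rewrite leNgt; apply/negP => xi.
  (* Near [x] the gap stays above [d], half its value at [x], whereas the points [s] attached to
     [u k] have gap at most [k.+1%:R^-1]. *)
  pose d := (x 0 i - f x 0 i) / 2.
  have d0 : 0 < d by rewrite divr_gt0 // subr_gt0.
  have : within (@simplex R n) (nbhs x) [set y : 'rV[R]_n | d < y 0 i - f y 0 i].
    have : (fun y : 'rV[R]_n => y 0 i - f y 0 i) @ within (@simplex R n) (nbhs x)
        --> x 0 i - f x 0 i.
      apply: cvgB; first by apply: cvg_within_filter; exact: coord_continuous.
      exact: (cvg_comp _ _ (fC x xS) (@coord_continuous R 1 n 0 i (f x))).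
    by move=> lim_x; apply: (cvgr_gt _ lim_x); rewrite /d; lra.
  move=> /nbhs_ballP[r /= r0 xr].
  (* The bound [r / 2] serves the triangle inequality through [u k], the bound [d] contradicts the
     gap. *)
  pose e := Num.min d (r / 2).
  have r2 : 0 < r / 2 by rewrite divr_gt0.
  have e0 : 0 < e by rewrite lt_min d0 r2.
  have [k0 _ k0e] := near_infty_natSinv_lt (PosNum e0).
  have [|/= _ [[k kk0 <-] xuk]] := xu (u @` [set k | (k0 <= k)%N]) (ball x (r / 2)) _
      (nbhsx_ballx _ _ r2).
    by exists k0 => // k kk0; exists k.
  have [_ /(_ i)[s [sS us] si]] := uP k.
  have := k0e k kk0; rewrite /= lt_min => /andP[kd kr].
  have xs : ball x r s.
    rewrite [r]splitr; apply: ball_triangle xuk _.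
    exact: le_ball (ltW kr) _ us.
  have /= ds := xr s xs sS.
  have := lt_le_trans ds (lerB si (lexx _)).
  by rewrite addrAC subrr add0r => /(lt_trans kd); rewrite ltxx.
exists x => //; apply/rowP => i; apply/eqP; rewrite eq_le x_le andbT leNgt.
apply/negP => xi; have [_ x1] := xS; have [_ fx1] := fS x xS.
suff : \sum_j x 0 j < \sum_j f x 0 j by rewrite x1 fx1 ltxx.
by rewrite (bigD1 i) //= [ltRHS](bigD1 i) //= ltr_leD // ler_sum.
Qed.

(** * Positive eigenvectors and stationary distributions *)

Lemma continuous_within_comp (T U V : topologicalType) (A : set U)
    (f : U -> V) (g : T -> U) :
    {within A, continuous f} -> continuous g -> (forall x, A (g x)) ->
  continuous (f \o g).
Proof.
move=> /subspace_continuousP fC gC gA x.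
apply: (cvg_comp g f _ (fC (g x) (gA x))) => B /= /gC.
by rewrite /nbhs /=; apply: filterS => y; apply; exact: gA.
Qed.

Section Normalize.
Variables (R : realType) (n : nat).

Definition normalize (w : 'rV[R]_n) : 'rV[R]_n := (\sum_j w 0 j)^-1 *: w.

Lemma normalize_simplex (w : 'rV[R]_n) :
  (forall j, 0 <= w 0 j) -> 0 < \sum_j w 0 j -> simplex (normalize w).
Proof.
move=> w0 sw0; split=> [j|]; first by rewrite mxE mulr_ge0 // invr_ge0 ltW.
under eq_bigr do rewrite mxE.
by rewrite -mulr_sumr mulVf // gt_eqF.
Qed.

Lemma continuous_normalize (T : topologicalType) (g : T -> 'rV[R]_n) :
    (forall j, continuous (fun x => g x 0 j)) ->
    (forall x, \sum_j g x 0 j != 0) ->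
  continuous (fun x => normalize (g x)).
Proof.
move=> gC g0 x; apply: cvg_rV => j.
rewrite mxE; under eq_fun do rewrite mxE.
apply: cvgM; last exact: gC.
by apply: cvgV => //; apply: cvg_sumr => i; exact: gC.
Qed.

(* Total version of the rescaling [w |-> w / \sum_j w_j]: the second term
   vanishes when the entries of [w >= 0] sum to [1/2], and prevents the
   denominator from vanishing elsewhere. *)
Definition rescale (w : 'rV[R]_n) : 'rV[R]_n :=
  normalize (\row_j (`|w 0 j| + `|2^-1 - \sum_k `|w 0 k| |)).

Lemma rescale_half (w : 'rV[R]_n) : (forall j, 0 <= w 0 j) ->
  \sum_j w 0 j = 2^-1 -> rescale w = 2 *: w.
Proof.
move=> w0 wsum.
have wE : \sum_j `|w 0 j| = 2^-1.
  by rewrite -wsum; apply: eq_bigr => j _; rewrite ger0_norm.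
rewrite /rescale wE subrr normr0.
have -> : \row_j (`|w 0 j| + 0) = w.
  by apply/rowP => j; rewrite mxE addr0 ger0_norm.
by rewrite /normalize wsum invrK.
Qed.

Hypothesis n_gt0 : (0 < n)%N.

(** With [s] the sum of the absolute values, a single copy of the second term suffices, as
    [s + (2^-1 - s)] is positive. *)
Lemma rescale_sum_gt0 (w : 'rV[R]_n) :
  0 < \sum_j (\row_j (`|w 0 j| + `|2^-1 - \sum_k `|w 0 k| |) : 'rV[R]_n) 0 j.
Proof.
under eq_bigr do rewrite mxE.
rewrite big_split /= sumr_const card_ord; set s := \sum_j _.
rewrite -[X in _ *+ X](prednK n_gt0) mulrS; have := ler_norm (2^-1 - s).
have : 0 <= `|2^-1 - s| *+ n.-1 by rewrite mulrn_wge0.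
lra.
Qed.

Lemma rescale_simplex (w : 'rV[R]_n) : simplex (rescale w).
Proof.
by apply: normalize_simplex => [j|]; [rewrite mxE addr_ge0 | exact: rescale_sum_gt0].
Qed.

Lemma continuous_rescale (T : topologicalType) (g : T -> 'rV[R]_n) :
  (forall j, continuous (fun x => g x 0 j)) ->
  continuous (fun x => rescale (g x)).
Proof.
move=> gC; apply: continuous_normalize => [j x|x]; last first.
  by rewrite gt_eqF // rescale_sum_gt0.
have gN k : `|g y 0 k| @[y --> x] --> `|g x 0 k| by apply: cvg_norm; exact: gC.
under eq_fun do rewrite mxE.
apply: cvgD; first exact: gN.
apply: cvg_norm; apply: cvgB; first exact: cvg_cst.
by apply: cvg_sumr => k; exact: gN.
Qed.

End Normalize.

(** [rescale] sends each half of any vector continuously into the simplex, so the map [f] below is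
    continuous on the whole space although [a] is only continuous within the simplex. *)
Lemma positive_fixed_point (R : realType) (d : nat)
    (a : 'I_d -> 'I_d -> 'rV[R]_d -> R) : (0 < d)%N ->
    (forall i j, {within @simplex R d, continuous (a i j)}) ->
    (forall i j x, 0 < a i j x) ->
  exists (p v : 'rV[R]_d) (mu : R), let Av i := \sum_j a i j p * v 0 j in
    [/\ simplex p, 0 < mu, forall i, 0 < v 0 i,
        forall i, Av i = mu * v 0 i &
        forall j, p 0 j = \sum_i p 0 i * (a i j p * v 0 j / Av i)].
Proof.
move=> d0 aC a0.
pose pi (z : 'rV[R]_(d + d)) := rescale (lsubmx z).
pose v (z : 'rV[R]_(d + d)) := rescale (rsubmx z).
have piS z : simplex (pi z) by exact: rescale_simplex.
have vS z : simplex (v z) by exact: rescale_simplex.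
have piC : continuous pi.
  apply: continuous_rescale => // j; rewrite /lsubmx.
  under eq_fun do rewrite mxE; move=> z; exact: coord_continuous.
have vC : continuous v.
  apply: continuous_rescale => // j; rewrite /rsubmx.
  under eq_fun do rewrite mxE; move=> z; exact: coord_continuous.
have coordC (g : 'rV[R]_(d + d) -> 'rV[R]_d) j :
    continuous g -> continuous (fun z => g z 0 j).
  by move=> gC z; exact: (cvg_comp _ _ (gC z) (@coord_continuous R 1 d 0 j (g z))).
pose av i j z := a i j (pi z) * v z 0 j.
have avC i j : continuous (av i j).
  move=> z; apply: (cvgM (F := nbhs z)); last exact: coordC.
  exact: (continuous_within_comp (aC i j) piC piS).
have av_ge0 i j z : 0 <= av i j z.
  by have [v_ge0 _] := vS z; rewrite mulr_ge0 ?(ltW (a0 _ _ _)).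
pose Av i z := \sum_j av i j z.
have AvC i : continuous (Av i).
  by move=> z; apply: (cvg_sumr (F := nbhs z)) => j; exact: avC.
(* The coordinates of [v z] sum to one, so one of them is positive. *)
have Av_gt0 i z : 0 < Av i z.
  have [v_ge0 v1] := vS z.
  rewrite lt_neqAle sumr_ge0 ?andbT // eq_sym psumr_neq0 //.
  have : \sum_j v z 0 j != 0 by rewrite v1 oner_neq0.
  rewrite psumr_neq0 // => /hasP[j _ /= vj]; apply/hasP.
  by exists j; [exact: mem_index_enum | exact: mulr_gt0].
have sAv_gt0 z : 0 < \sum_i (\row_i Av i z) 0 i.
  under eq_bigr do rewrite mxE.
  rewrite (bigD1 (Ordinal d0)) //= ltr_wpDr ?Av_gt0 // sumr_ge0 // => i _.
  exact: ltW.
pose K z := \row_j \sum_i pi z 0 i * (av i j z / Av i z).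
have KC j : continuous (fun z => K z 0 j).
  rewrite /K; under eq_fun do rewrite mxE; move=> z.
  apply: (cvg_sumr (F := nbhs z)) => i.
  apply: (cvgM (F := nbhs z)); first exact: coordC.
  apply: (cvgM (F := nbhs z)); first exact: avC.
  by apply: (cvgV (F := nbhs z)); [rewrite gt_eqF | exact: AvC].
have KS z : simplex (K z).
  have [pi0 pi1] := piS z; split=> [j|].
    by rewrite mxE sumr_ge0 // => i _; rewrite mulr_ge0 // divr_ge0 // ltW.
  under eq_bigr do rewrite mxE.
  rewrite exchange_big /= -[RHS]pi1; apply: eq_bigr => i _.
  rewrite -mulr_sumr -mulr_suml -/(Av i z) divff ?mulr1 //.
  by rewrite gt_eqF.
pose N z := normalize (\row_i Av i z).
have NS z : simplex (N z).
  by apply: normalize_simplex => // i; rewrite mxE ltW.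
have NC : continuous N.
  apply: continuous_normalize => [j|z]; last by rewrite gt_eqF.
  by under eq_fun do rewrite mxE; exact: AvC.
pose f z := row_mx (2^-1 *: K z) (2^-1 *: N z).
have [|||z _ fz] := @brouwer_simplex R (d + d) f; first by rewrite addn_gt0 d0.
- apply: continuous_subspaceT => z; apply: (cvg_rV (F := nbhs z)) => j.
  case: (split_ordP j) => k ->; rewrite /f.
    rewrite row_mxEl; under eq_fun do rewrite row_mxEl mxE.
    by rewrite mxE; apply: (cvgM (F := nbhs z)); [exact: cvg_cst | exact: KC].
  rewrite row_mxEr; under eq_fun do rewrite row_mxEr mxE.
  by rewrite mxE; apply: (cvgM (F := nbhs z)); [exact: cvg_cst | exact: coordC].
- move=> z _; have [[K0 K1] [N0 N1]] := (KS z, NS z); split=> [j|].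
    by rewrite mxE; case: splitP => k _; rewrite mxE mulr_ge0 ?invr_ge0.
  rewrite big_split_ord /=.
  under eq_bigr do rewrite row_mxEl mxE.
  under [X in _ + X]eq_bigr do rewrite row_mxEr mxE.
  rewrite -!mulr_sumr K1 N1; lra.
(* At the fixed point the halves of [z] are those of [K z] and [N z] scaled by [2^-1]; [rescale]
   undoes the scaling. *)
have halfE (w : 'rV[R]_d) : simplex w -> rescale (2^-1 *: w) = w.
  move=> [w0 w1]; rewrite rescale_half ?scalerA ?divff ?scale1r //.
    by move=> j; rewrite mxE mulr_ge0 ?invr_ge0.
  by under eq_bigr do rewrite mxE; rewrite -mulr_sumr w1 mulr1.
have piE : pi z = K z by rewrite /pi -{1}fz row_mxKl halfE.
have vE : v z = N z by rewrite /v -{1}fz row_mxKr halfE.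
(* The eigenvalue is the normalizing factor in [v z = N z]. *)
exists (pi z), (v z), (\sum_i (\row_i Av i z) 0 i); split=> //.
- by move=> i; rewrite vE mxE mulr_gt0 ?invr_gt0 ?sAv_gt0 // mxE.
- by move=> i; rewrite [in RHS]vE mxE mulrA divff ?gt_eqF // mul1r mxE.
- by move=> j; rewrite {1}piE mxE.
Qed.

(** * Solutions of the entropy penalized model *)

Unset Implicit Arguments.
Set Strict Implicit.

Theorem proposition9 (R : realType) (d : nat) (hd : (1 < d)%N)
    (eps : R) (heps : 0 < eps)
    (c : 'I_d -> 'I_d -> 'rV[R]_d -> R)
    (hc : forall i j : 'I_d, {within @simplex R d, continuous (c i j)}) :
  exists (pibar Vbar : 'rV[R]_d) (lambdabar : R),
    [/\ simplex pibar,
        ep_G eps c pibar Vbar = const_mx lambdabar + Vbar,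
        pibar = pibar *m ep_transition eps c pibar Vbar &
        pibar *m ep_transition eps c pibar Vbar = ep_K eps c Vbar pibar].
Proof.
pose a i j x := expR (- c i j x / eps).
have aC i j : {within @simplex R d, continuous (a i j)}.
  apply/subspace_continuousP => x xS.
  have /subspace_continuousP/(_ x xS) cx := hc i j.
  apply: (cvg_comp (fun y => - c i j y / eps) expR _
    (@continuous_expR R (- c i j x / eps))).
  by apply: cvgM; [apply: cvgN; exact: cx | exact: cvg_cst].
have [p [v [mu /= [pS mu0 v0 Av pE]]]] :=
  positive_fixed_point (ltnW hd) aC (fun i j x => expR_gt0 _).
(* Inverts [v_j = exp (- V_j / eps)], which is possible since [v] is positive. *)
pose V : 'rV[R]_d := \row_j (- eps * ln (v 0 j)).
have expE i j : expR (- (c i j p + V 0 j) / eps) = a i j p * v 0 j.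
  rewrite mxE /a -{2}(@lnK _ (v 0 j)) ?posrE // -expRD; congr expR.
  by field; rewrite gt_eqF.
have sumE i : \sum_k expR (- (c i k p + V 0 k) / eps) = mu * v 0 i.
  by rewrite -Av; apply: eq_bigr => k _; exact: expE.
(* The log-sum-exp form of [ep_G] equals [- eps * ln (mu * v 0 i)], which splits into this constant
   and [V 0 i]. *)
exists p, V, (- eps * ln mu); split=> //.
  apply/rowP => i; rewrite ep_GE // sumE !mxE lnM ?posrE //; ring.
apply/rowP => j; rewrite pE mxE; apply: eq_bigr => i _.
by rewrite mxE expE sumE Av.
Qed.
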